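(* Let $H_1$ and $H_2$ be separable Hilbert spaces, and let $\{f_n\}_{n\in\mathbb{N}}$ and $\{g_m\}_{m\in\mathbb{N}}$ be sequences in $H_1$ and $H_2$ respectively such that the analysis operator $C_1$ of $\{f_n\}_{n\in\mathbb{N}}$ and the analysis operator $C_2$ of $\{g_m\}_{m\in\mathbb{N}}$ are densely defined. Then $\{f_n\}_{n\in\mathbb{N}}$ and $\{g_m\}_{m\in\mathbb{N}}$ are lower semi-frames for $H_1$ and $H_2$ respectively if and only if $\{f_n\otimes g_m\}_{n,m\in\mathbb{N}}$ is a lower semi-frame for $H_1\otimes H_2$.
   Context: $H_1\otimes H_2$ is the Hilbert space tensor product, i.e. the completion of the algebraic tensor product with respect to $\langle f_1\otimes g_1,f_2\otimes g_2\rangle=\langle f_1,f_2\rangle_{H_1}\langle g_1,g_2\rangle_{H_2}$. For a countable sequence $\{f_n\}$ in a Hilbert space $H$: it is complete if $\overline{\mathrm{span}}\{f_n\}=H$; it is a lower semi-frame for $H$ if it is complete in $H$ and there is a constant $A>0$ with $A\|f\|^2\le\sum_n|\langle f,f_n\rangle|^2$ for all $f\in H$ (the sum may be infinite). The analysis operator $C$ of $\{f_n\}_{n\in\mathbb{N}}$ is $C:\mathrm{Dom}(C)\subseteq H\to\ell^2(\mathbb{N})$ with $\mathrm{Dom}(C)=\{f\in H:\sum_n|\langle f,f_n\rangle|^2<\infty\}$ and $Cf=\{\langle f,f_n\rangle\}_n$; densely defined means $\mathrm{Dom}(C)$ is dense in $H$.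
   Formalization: The Hilbert spaces H_1 and H_2 are assumed to be nonzero; otherwise the ''if'' direction fails, e.g. for H_1 = {0}, H_2 = C and g_m = 0 for all m. *)

(* Defs.v *)
From HB Require Import structures.
From mathcomp Require Import all_boot all_order all_algebra.
From mathcomp Require Import generic_quotient ring_quotient sesquilinear.
From mathcomp Require Import complex monalg.
From mathcomp Require Import all_classical all_reals all_analysis.

Set Implicit Arguments.
Unset Strict Implicit.
Unset Printing Implicit Defensive.

Import Order.TTheory GRing.Theory Num.Theory.
Import numFieldNormedType.Exports.

Local Open Scope classical_set_scope.
Local Open Scope ring_scope.
Local Open Scope quotient_scope.

(* The inner product is linear in the first argument and conjugate-linear in
   the second one, as is {dot _ for _}. *)
HB.mixin Record isHilbert (R : realType) (V : Type)
    of CompleteNormedModule R[i] V := {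
  inner : {dot V for (@Num.conj R[i])} ;
  inner_normE : forall x : V, inner x x = `|x| ^+ 2
}.

#[short(type="hilbertType")]
HB.structure Definition Hilbert (R : realType) :=
  {V of CompleteNormedModule R[i] V & isHilbert R V}.

Section Tensor.
Context {R : realType}.

Section AlgebraicTensor.
Variables U V : lmodType R[i].

Local Notation pairs := (U * V)%type.
Local Notation pure u v := (<< ((u, v) : pairs) >> : {malg R[i][pairs]}).

(* The subspace of the free vector space on U * V generated by the relations
   expressing that (u, v) |-> u (x) v is bilinear. *)
Inductive bilinear_relation : {malg R[i][pairs]} -> Prop :=
| BilinDl (u u' : U) (v : V) :
    bilinear_relation (pure (u + u') v - pure u v - pure u' v)
| BilinDr (u : U) (v v' : V) :
    bilinear_relation (pure u (v + v') - pure u v - pure u v')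
| BilinZl (a : R[i]) (u : U) (v : V) :
    bilinear_relation (pure (a *: u) v - a *: pure u v)
| BilinZr (a : R[i]) (u : U) (v : V) :
    bilinear_relation (pure u (a *: v) - a *: pure u v)
| Bilin0 : bilinear_relation 0
| BilinP (a : R[i]) (x y : {malg R[i][pairs]}) :
    bilinear_relation x -> bilinear_relation y ->
    bilinear_relation (a *: x + y).

Definition bilinear_relb : {pred {malg R[i][pairs]}} :=
  [pred x | `[< bilinear_relation x >]].

Lemma bilinear_relbP x : reflect (bilinear_relation x) (x \in bilinear_relb).
Proof. exact: asboolP. Qed.

Fact bilinear_relb_submod : submod_closed bilinear_relb.
Proof.
split=> [|a x y]; first by apply/bilinear_relbP; exact: Bilin0.
by move=> /bilinear_relbP rx /bilinear_relbP ry;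
  apply/bilinear_relbP; exact: BilinP.
Qed.

HB.instance Definition _ :=
  GRing.isSubmodClosed.Build R[i] {malg R[i][pairs]} bilinear_relb
    bilinear_relb_submod.

Definition alg_tensor : Type := Quotient.quot bilinear_relb.
HB.instance Definition _ := GRing.Zmodule.on alg_tensor.

Definition pi_tensor (x : {malg R[i][pairs]}) : alg_tensor :=
  \pi_(Quotient.quot bilinear_relb) x.

Lemma pi_tensorE x y :
  pi_tensor x = pi_tensor y <-> bilinear_relation (x - y).
Proof.
split=> [/eqP|r].
  by rewrite /pi_tensor -Quotient.idealrBE => /bilinear_relbP.
by apply/eqP; rewrite /pi_tensor -Quotient.idealrBE; apply/bilinear_relbP.
Qed.

Lemma pi_tensor_surj (t : alg_tensor) : exists x, t = pi_tensor x.
Proof.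
by exists (repr (t : Quotient.quot bilinear_relb)); rewrite /pi_tensor reprK.
Qed.

Lemma pi_tensorD x y : pi_tensor (x + y) = pi_tensor x + pi_tensor y.
Proof. by rewrite /pi_tensor raddfD. Qed.

Definition scale_tensor (a : R[i]) (t : alg_tensor) : alg_tensor :=
  pi_tensor (a *: repr (t : Quotient.quot bilinear_relb)).

Lemma scale_tensorE a x : scale_tensor a (pi_tensor x) = pi_tensor (a *: x).
Proof.
apply/pi_tensorE; rewrite -scalerBr -[a *: _]addr0.
apply: BilinP; last exact: Bilin0.
by apply/pi_tensorE; rewrite /pi_tensor reprK.
Qed.

Fact scale_tensorA a b t :
  scale_tensor a (scale_tensor b t) = scale_tensor (a * b) t.
Proof.
by have [x ->] := pi_tensor_surj t; rewrite !scale_tensorE scalerA.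
Qed.

Fact scale1_tensor : left_id 1 scale_tensor.
Proof.
by move=> t; have [x ->] := pi_tensor_surj t; rewrite scale_tensorE scale1r.
Qed.

Fact scale_tensorDr : right_distributive scale_tensor +%R.
Proof.
move=> a t s; have [x ->] := pi_tensor_surj t; have [y ->] := pi_tensor_surj s.
by rewrite -pi_tensorD !scale_tensorE scalerDr pi_tensorD.
Qed.

Fact scale_tensorDl t : {morph scale_tensor^~ t : a b / a + b}.
Proof.
move=> a b; have [x ->] := pi_tensor_surj t.
by rewrite !scale_tensorE scalerDl pi_tensorD.
Qed.

HB.instance Definition _ := GRing.Zmodule_isLmodule.Build R[i] alg_tensor
  scale_tensorA scale1_tensor scale_tensorDr scale_tensorDl.

Definition pure_tensor (u : U) (v : V) : alg_tensor := pi_tensor (pure u v).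

End AlgebraicTensor.
End Tensor.

Notation "u ⊗ v" := (pure_tensor u v) (at level 40, left associativity).

Section Frames.
Context {R : realType}.

(* (H, iota) is the completion of the algebraic tensor product for the inner
   product determined by
     <f1 ⊗ g1, f2 ⊗ g2> = <f1, f2> * <g1, g2>;
   the first clause says that iota is isometric for that inner product, since
   pure tensors span alg_tensor H1 H2. The map iota is thus injective. *)
Definition is_hilbert_tensor (H1 H2 H : hilbertType R)
    (iota : {linear alg_tensor H1 H2 -> H}) : Prop :=
  (forall (f1 f2 : H1) (g1 g2 : H2),
     inner (iota (f1 ⊗ g1)) (iota (f2 ⊗ g2)) = inner f1 f2 * inner g1 g2) /\
  dense (range iota).

Definition separable (T : topologicalType) : Prop :=
  exists2 D : set T, countable D & dense D.

Definition lin_span (V : lmodType R[i]) (A : set V) : set V :=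
  [set x | exists (n : nat) (c : 'I_n -> R[i]) (v : 'I_n -> V),
     (forall i, A (v i)) /\ x = \sum_(i < n) c i *: v i].

(* Norms over R[i] take values in R[i]; the sum may be +oo. *)
Definition sqr_sum (I : choiceType) (c : I -> R[i]) : \bar R :=
  \esum_(i in [set: I]) ((complex.Re `|c i|) ^+ 2)%:E.

Section Family.
Variables (H : hilbertType R) (I : countType) (f : I -> H).

Definition analysis (x : H) : I -> R[i] := fun i => inner x (f i).

Definition complete_family : Prop := closure (lin_span (range f)) = setT.

Definition lower_semi_frame : Prop :=
  complete_family /\
  exists2 A : R, 0 < A &
    forall x : H, ((A * (complex.Re `|x|) ^+ 2)%:E <= sqr_sum (analysis x))%E.

(* The analysis operator is the restriction of analysis to this domain, i.e.
   to the x whose coefficients are in l^2(I). *)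
Definition analysis_dom : set H := [set x | (sqr_sum (analysis x) < +oo)%E].

Definition analysis_densely_defined : Prop := dense analysis_dom.

End Family.
End Frames.

(* Main.v *)
(** Write |x| for the norm. Suppose f and g have lower bounds A and B, and let
    h be in H. By Riesz there are v_m in H1 and, for every orthonormal e_1, ...,
    e_K in H1, w_k in H2 with <v_m, x> = <h, x ⊗ g_m> and
    <w_k, y> = <h, e_k ⊗ y>. The bound for g, Bessel's inequality and the bound
    for f give
      A B sum_k |w_k|^2 <= A sum_m sum_k |<h, e_k ⊗ g_m>|^2
                        <= A sum_m |v_m|^2 <= sum_{n,m} |<h, f_n ⊗ g_m>|^2.
    Every algebraic tensor can be written t = sum_k e_k ⊗ y_k with e_k
    orthonormal, and 2 Re <w_k, y_k> <= |w_k|^2 + |y_k|^2 then yields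
    |h|^2 - |h - t|^2 <= sum_k |w_k|^2; let t tend to h. Conversely, the sum of
    squares at x ⊗ y factors, so evaluating at a fixed nonzero y in the domain
    of C_2 bounds f from below, and symmetrically for g. A lower bound implies
    completeness, because a vector orthogonal to the family vanishes. *)
Require Import Defs.
From HB Require Import structures.
From mathcomp Require Import all_boot all_order all_algebra.
From mathcomp Require Import complex sesquilinear monalg ring lra.
From mathcomp Require Import all_classical all_reals all_analysis.

Set Implicit Arguments.
Unset Strict Implicit.
Unset Printing Implicit Defensive.

Import Order.TTheory GRing.Theory Num.Theory.
Import numFieldNormedType.Exports.

Local Open Scope classical_set_scope.
Local Open Scope ring_scope.

(** * Real-valued norm and inner product on a Hilbert space *)

Section HilbertGeometry.
Context {R : realType} {V : hilbertType R}.
Implicit Types x y z : V.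

(** The norm of the space takes values in [R[i]]; passing to [R] gives a total order, with infima
    and real arithmetic. *)
Definition nrm x : R := complex.Re `|x|.
Definition rinner x y : R := complex.Re (inner x y).

Lemma nrmE x : (nrm x)%:C%C = `|x|.
Proof. by rewrite /nrm RRe_real// ger0_real. Qed.

Lemma nrm_ge0 x : 0 <= nrm x.
Proof. by rewrite -ler0c nrmE. Qed.

Lemma nrm0 : nrm 0 = 0.
Proof. by rewrite /nrm normr0. Qed.

Lemma nrm_eq0 x : (nrm x == 0) = (x == 0).
Proof. by rewrite -[x == 0]normr_eq0 -nrmE -(inj_eq (@complexI _)). Qed.

Lemma nrm_distC x y : nrm (x - y) = nrm (y - x).
Proof. by rewrite /nrm distrC. Qed.

Lemma nrmD x y : nrm (x + y) <= nrm x + nrm y.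
Proof. by rewrite -lecR rmorphD /= !nrmE ler_normD. Qed.

Lemma nrmZ (a : R[i]) x : nrm (a *: x) = complex.Re `|a| * nrm x.
Proof.
apply: (@complexI R); rewrite rmorphM/= !nrmE normrZ; congr (_ * _).
Qed.

Lemma innerC x y : inner x y = Num.conj (inner y x).
Proof. by rewrite hermC expr0 mul1r. Qed.

Lemma innerDl x y z : inner (x + y) z = inner x z + inner y z.
Proof. exact: linearDl. Qed.

Lemma innerNl x z : inner (- x) z = - inner x z.
Proof. exact: linearNl. Qed.

Lemma innerZl (a : R[i]) x z : inner (a *: x) z = a * inner x z.
Proof. exact: linearZl_LR. Qed.

Lemma inner0l z : inner 0 z = 0.
Proof. exact: linear0l. Qed.

Lemma innerDr z x y : inner z (x + y) = inner z x + inner z y.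
Proof. exact: linearDr. Qed.

Lemma innerZr (a : R[i]) z x : inner z (a *: x) = Num.conj a * inner z x.
Proof. exact: linearZr_LR. Qed.

Lemma inner0r z : inner z 0 = 0.
Proof. exact: linear0r. Qed.

Lemma inner_suml n (F : nat -> V) z :
  inner (\sum_(i < n) F i) z = \sum_(i < n) inner (F i) z.
Proof.
elim: n => [|n IHn]; first by rewrite !big_ord0 inner0l.
by rewrite !big_ord_recr /= innerDl IHn.
Qed.

Lemma inner_sumr z n (F : nat -> V) :
  inner z (\sum_(i < n) F i) = \sum_(i < n) inner z (F i).
Proof.
elim: n => [|n IHn]; first by rewrite !big_ord0 inner0r.
by rewrite !big_ord_recr /= innerDr IHn.
Qed.

Lemma rinnerC x y : rinner x y = rinner y x.
Proof. by rewrite /rinner innerC; case: (inner y x). Qed.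

Lemma nrm_sqr x : nrm x ^+ 2 = rinner x x.
Proof. by rewrite /rinner inner_normE -nrmE -rmorphXn. Qed.

Lemma rinnerDl x y z : rinner (x + y) z = rinner x z + rinner y z.
Proof. by rewrite /rinner innerDl; case: (inner x z); case: (inner y z). Qed.

Lemma rinnerNl x z : rinner (- x) z = - rinner x z.
Proof. by rewrite /rinner innerNl; case: (inner x z). Qed.

Lemma rinnerZl (t : R) x z : rinner (t%:C%C *: x) z = t * rinner x z.
Proof.
rewrite /rinner innerZl; case: (inner x z) => a b /=.
by rewrite mul0r subr0.
Qed.

Lemma nrm_sqrB x y :
  nrm (x - y) ^+ 2 = nrm x ^+ 2 + nrm y ^+ 2 - 2 * rinner x y.
Proof.
rewrite !nrm_sqr rinnerDl rinnerNl ![rinner _ (x - y)]rinnerC.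
by rewrite !rinnerDl !rinnerNl (rinnerC y x); ring.
Qed.

Lemma nrm_sqrBZ (t : R) x y :
  nrm (x - t%:C%C *: y) ^+ 2 =
  nrm x ^+ 2 + t ^+ 2 * nrm y ^+ 2 - 2 * t * rinner x y.
Proof.
rewrite nrm_sqrB (rinnerC x) rinnerZl (rinnerC y) (nrm_sqr (_ *: _)) rinnerZl.
by rewrite (rinnerC y) rinnerZl -nrm_sqr; ring.
Qed.

Lemma nrm_sqrD x y :
  nrm (x + y) ^+ 2 = nrm x ^+ 2 + nrm y ^+ 2 + 2 * rinner x y.
Proof.
rewrite -{1}[y]opprK nrm_sqrB rinnerC rinnerNl (rinnerC y).
by rewrite [nrm (- y)]/nrm normrN mulrN opprK.
Qed.

Lemma rinner_le (x y : V) : `|rinner x y| <= nrm x * nrm y.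
Proof.
have [->|y0] := eqVneq y 0.
  by rewrite nrm0 mulr0 /rinner inner0r normr0.
have ny0 : 0 < nrm y by rewrite lt0r nrm_eq0 y0 nrm_ge0.
rewrite -(@ler_pXn2r _ 2)// ?nnegrE ?mulr_ge0 ?nrm_ge0// real_normK ?num_real//.
(* This real coefficient minimizes |x - t y|; expanding the square there gives Cauchy-Schwarz. *)
have := sqr_ge0 (nrm (x - (rinner x y / nrm y ^+ 2)%:C%C *: y)).
rewrite nrm_sqrBZ.
set q := nrm y in ny0 *; set r := rinner x y; set p := nrm x.
rewrite (_ : _ - _ = (p ^+ 2 * q ^+ 2 - r ^+ 2) / q ^+ 2); last first.
  by field; rewrite gt_eqF.
by rewrite pmulr_lge0 ?invr_gt0 ?exprn_gt0// subr_ge0 exprMn.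
Qed.

(** Completeness restated with real radii: every positive element of [R[i]] is a positive real. *)
Lemma cauchy_nrm (u : nat -> V) :
  (forall e : R, 0 < e ->
     exists n0, forall m n, (n0 <= m)%N -> (n0 <= n)%N ->
       nrm (u m - u n) < e) ->
  exists p, forall e : R, 0 < e ->
     exists n0, forall n, (n0 <= n)%N -> nrm (p - u n) < e.
Proof.
move=> Cu.
have posE (e : R[i]) : 0 < e -> exists2 r, 0 < r & e = r%:C%C.
  move=> e0; exists (complex.Re e); last by rewrite RRe_real// gtr0_real.
  by rewrite -ltcR RRe_real// gtr0_real.
have /cauchy_cvg cu : cauchy (u @ \oo).
  apply/cauchy_ballP => _ /posE[e e0 ->].
  have [n0 n0P] := Cu e e0.
  exists ([set u n | n in [set n | (n0 <= n)%N]],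
          [set u n | n in [set n | (n0 <= n)%N]]) => /=.
    by split; exists n0 => // n /= n0n; exists n.
  case=> _ _ [/= [m n0m <-] [n n0n <-]].
  by rewrite -ball_normE /= -nrmE ltcR; apply: n0P.
exists (lim (u @ \oo)) => e e0.
move/cvg_ballP : cu => /(_ e%:C%C); rewrite ltcR => /(_ e0) [n0 _ n0P].
exists n0 => n n0n; have := n0P n n0n.
by rewrite /= -ball_normE /= -nrmE ltcR.
Qed.

Lemma dense_nrm (S : set V) : dense S ->
  forall x (e : R), 0 < e -> exists2 y, S y & nrm (x - y) < e.
Proof.
move=> dS x e e0.
have [|y [xy Sy]] := dS (ball x e%:C%C) _ (ball_open _ _).
  by exists x; apply: ballxx; rewrite ltcR.
exists y => //; move: xy.
by rewrite -ball_normE /= -nrmE ltcR.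
Qed.

Lemma closure_nrm (S : set V) x :
  closure S x <-> forall e : R, 0 < e -> exists2 y, S y & nrm (x - y) < e.
Proof.
split=> [Sx e e0|Sx B].
  have [|y [Sy xy]] := Sx (ball x e%:C%C).
    by apply: nbhsx_ballx; rewrite ltcR.
  by exists y => //; move: xy; rewrite -ball_normE /= -nrmE ltcR.
rewrite -nbhs_ballE => -[e /= e0 xB].
have eE : e = (complex.Re e)%:C%C by rewrite RRe_real// gtr0_real.
have [|y Sy xy] := Sx (complex.Re e); first by rewrite -ltcR -eE.
exists y; split => //; apply: xB.
by rewrite -ball_normE /= -nrmE eE ltcR.
Qed.

End HilbertGeometry.

(** * Nearest points and density of subspaces *)

Lemma ler_quad_eq0 (F : realFieldType) (q r : F) :
  0 <= q -> (forall t, 2 * t * r <= t ^+ 2 * q) -> r = 0.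
Proof.
move=> q0 h; have q1 : 0 < q + 1 by lra.
(* The divisor is [q + 1] rather than [q], which may vanish. With this t the difference of the two
   sides is - t^2 (q + 2), which forces t = 0. *)
have := h (r / (q + 1)).
rewrite -subr_ge0 (_ : _ - _ = - (r / (q + 1)) ^+ 2 * (q + 2)); last first.
  by field; lra.
rewrite mulNr oppr_ge0 pmulr_lle0; last by lra.
move=> s0; have /eqP : (r / (q + 1)) ^+ 2 = 0.
  by apply/le_anti; rewrite s0 sqr_ge0.
by rewrite sqrf_eq0 mulf_eq0 invr_eq0 [q + 1 == 0]gt_eqF// orbF => /eqP.
Qed.

Section Projection.
Context {R : realType} {V : hilbertType R}.

Lemma parallelogram (x y : V) :
  nrm (x - y) ^+ 2 + nrm (x + y) ^+ 2 = 2 * nrm x ^+ 2 + 2 * nrm y ^+ 2.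
Proof. by rewrite nrm_sqrB nrm_sqrD; ring. Qed.

(** Turns the sum in the parallelogram law into twice the distance from [x] to a midpoint, which
    lies in any subspace containing [a] and [b]. *)
Lemma nrm_mean (x a b : V) :
  nrm ((x - a) + (x - b)) = 2 * nrm (x - 2^-1 *: (a + b)).
Proof.
have -> : 2 = complex.Re `|2 : R[i]|.
  by rewrite normr_nat -(rmorph_nat (real_complex R)).
rewrite -nrmZ scalerBr scalerA divff ?pnatr_eq0// scale1r scaler_nat mulr2n.
by rewrite opprD addrACA.
Qed.

Lemma rinner_eq0 (z : V) (M : set V) :
  (forall a m, M m -> M (a *: m)) ->
  (forall m, M m -> rinner z m = 0) -> forall m, M m -> inner z m = 0.
Proof.
(* Testing against i m as well as m recovers the imaginary part. *)
move=> MZ zM m Mm; have := zM _ (MZ 'i%C _ Mm); have := zM _ Mm.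
rewrite /rinner innerZr; case: (inner z m) => a b /= -> /eqP.
by rewrite mulr0 add0r mulN1r opprK => /eqP ->.
Qed.

(** A minimizing sequence for the distance from [x] to [M] converges to some [p], and [x - p] is
    orthogonal to [M], hence zero; so the sequence itself approximates [x]. *)
Lemma orthogonal_trivial_dense (M : set V) :
  M 0 -> (forall a x y, M x -> M y -> M (a *: x + y)) ->
  (forall z, (forall m, M m -> inner z m = 0) -> z = 0) ->
  forall x (e : R), 0 < e -> exists2 m, M m & nrm (x - m) < e.
Proof.
move=> M0 ML Morth x.
have MD a b : M a -> M b -> M (a + b).
  by move=> Ma Mb; rewrite -[a]scale1r; apply: ML.
have MZ c a : M a -> M (c *: a).
  by move=> Ma; rewrite -[_ *: _]addr0; apply: ML.
pose E := [set nrm (x - m) | m in M]; pose d := inf E.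
have E_inf : has_inf E.
  split; first by exists (nrm (x - 0)), 0.
  by exists 0 => _ [m _ <-]; apply: nrm_ge0.
have d_le m : M m -> d <= nrm (x - m).
  by move=> Mm; apply: ge_inf; [case: E_inf | exists m].
have d0 : 0 <= d.
  by apply: lb_le_inf; [case: E_inf | move=> _ [m _ <-]; apply: nrm_ge0].
have /choice[u uP] (n : nat) : exists m, M m /\ nrm (x - m) < d + n.+1%:R^-1.
  have [|_ [m Mm <-] xm] := @inf_adherent _ E n.+1%:R^-1 _ E_inf.
    by rewrite invr_gt0 ltr0n.
  by exists m.
have uM n : M (u n) by case: (uP n).
have u_lt n0 n : (n0 <= n)%N -> nrm (x - u n) < d + n0.+1%:R^-1.
  move=> n0n; case: (uP n) => _ /lt_le_trans; apply.
  by rewrite lerD2l lef_pV2 ?posrE ?ltr0n// ler_nat.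
(* By the parallelogram law a minimizing sequence is Cauchy:
   |u_m - u_n|^2 <= 4 (d + de)^2 - 4 d^2. *)
have [e e0|p pP] := @cauchy_nrm R V u.
  (* For [de <= 1], 4 (d + de)^2 - 4 d^2 <= (8 d + 4) de, so 1 / (n0 + 1) is taken below e^2 / (8 d
     + 4). *)
  have k0 : 0 < 8 * d + 4 by lra.
  have [n0] := ltr_add_invr (divr_gt0 (exprn_gt0 2 e0) k0).
  rewrite add0r ltr_pdivlMr// => n0P; exists n0 => m n n0m n0n.
  have := u_lt _ _ n0m; have := u_lt _ _ n0n.
  set de := n0.+1%:R^-1 in n0P *.
  have de0 : 0 < de by rewrite invr_gt0 ltr0n.
  have de1 : de <= 1 by rewrite invf_le1 ?ltr0n// ler1n.
  have := parallelogram (x - u n) (x - u m); rewrite nrm_mean.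
  rewrite (_ : x - u n - (x - u m) = u m - u n); last first.
    by rewrite opprB addrC addrA subrK.
  have := d_le _ (MZ 2^-1 _ (MD _ _ (uM n) (uM m))).
  have := nrm_ge0 (x - u n); have := nrm_ge0 (x - u m).
  have := nrm_ge0 (u m - u n).
  move: (nrm (u m - u n)) (nrm (x - u n)) (nrm (x - u m)) (nrm (x - 2^-1 *: _)).
  move=> s a b c s0 b0 a0 dc par ad bd.
  have a2 : a ^+ 2 <= (d + de) ^+ 2 by rewrite ler_pXn2r ?nnegrE//; lra.
  have b2 : b ^+ 2 <= (d + de) ^+ 2 by rewrite ler_pXn2r ?nnegrE//; lra.
  have c2 : d ^+ 2 <= c ^+ 2 by rewrite ler_pXn2r ?nnegrE//; lra.
  have de2 : de ^+ 2 <= de by rewrite expr2 ler_piMr// ltW.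
  rewrite -(@ltr_pXn2r _ 2)// ?nnegrE ?s0 ?(ltW e0)//.
  by apply: le_lt_trans n0P; nra.
(* In the limit [p] realizes the distance [d], and [p + m], a limit of the points [u n + m] of [M],
   is no closer to [x]. *)
have [z_le z_ge] : nrm (x - p) <= d /\ forall m, M m -> d <= nrm (x - p - m).
  split=> [|m Mm]; apply/ler_addgt0Pr => e e0.
    have e20 : 0 < e / 2 by lra.
    have [n0 n0P] := pP _ e20; have [n1] := @ltr_add_invr _ 0 _ e20.
    rewrite add0r => n1P.
    have n01 := leq_maxl n0 n1; have n10 := leq_maxr n0 n1.
    have := n0P _ n01; have := u_lt _ _ n10; rewrite (nrm_distC p).
    have := nrmD (x - u (maxn n0 n1)) (u (maxn n0 n1) - p).
    by rewrite addrA subrK; move: n1P; set k := n1.+1%:R^-1; lra.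
  have [n0 /(_ _ (leqnn _)) n0P] := pP _ e0.
  have := d_le _ (MD _ _ (uM n0) Mm).
  have := nrmD (x - p - m) (p - u n0).
  rewrite (_ : x - p - m + (p - u n0) = x - (u n0 + m)); first by lra.
  by rewrite addrACA addrA subrK opprD addrAC addrA addrAC.
(* Replacing m by t m in the minimality of |x - p| gives 2 t Re<x - p, m> <= t^2 |m|^2 for all real
   t. *)
have z0 : x - p = 0.
  apply/Morth/rinner_eq0 => // m Mm.
  apply: (@ler_quad_eq0 _ (nrm m ^+ 2)); first by rewrite exprn_ge0 ?nrm_ge0.
  move=> t; have := z_ge _ (MZ t%:C%C _ Mm).
  move/(le_trans z_le); rewrite -(@ler_pXn2r _ 2)// ?nnegrE ?nrm_ge0//.
  by rewrite nrm_sqrBZ; lra.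
move=> e /pP[n0 /(_ _ (leqnn _)) n0P]; exists (u n0) => //.
by move/eqP: z0; rewrite subr_eq0 => /eqP ->.
Qed.

End Projection.

(** * Riesz representation *)

Section Riesz.
Context {R : realType} {V W : hilbertType R}.

(** The vector [w] is the adjoint of [T] applied to [h]. As in the Riesz theorem, it is zero or a
    rescaled vector orthogonal to the kernel of x -> <T x, h>. *)
Lemma riesz_adjoint (T : V -> W) (h : W) (c : R) : 0 <= c ->
  (forall a x y, T (a *: x + y) = a *: T x + T y) ->
  (forall x, nrm (T x) <= c * nrm x) ->
  exists w, forall x, inner w x = inner h (T x).
Proof.
move=> c0 TL Tc; pose psi x := inner (T x) h.
have psiL a x y : psi (a *: x + y) = a * psi x + psi y.
  by rewrite /psi TL innerDl innerZl.
have psi0 : psi 0 = 0.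
  by have := psiL (-1) 0 0; rewrite scaler0 addr0 mulN1r addNr.
have psiZ a x : psi (a *: x) = a * psi x.
  by rewrite -[a *: x]addr0 psiL psi0 addr0.
suff [z zP] : exists z, forall x, inner z x = (psi x)^*.
  by exists z => x; rewrite zP /psi -innerC.
pose M := [set x | psi x = 0].
have [Mtriv|/existsNP[z /not_implyP[zM /eqP z0]]] :=
    pselect (forall z, (forall m, M m -> inner z m = 0) -> z = 0).
  (* Only 0 is orthogonal to the kernel, so the kernel is dense and the bounded functional [psi]
     vanishes. *)
  exists 0 => x; rewrite inner0l; suff -> : psi x = 0 by rewrite conjC0.
  have re0 y : rinner (T y) h = 0.
    apply/eqP; rewrite -normr_le0; apply/ler_addgt0Pr => e e0; rewrite add0r.
    (* Adding 1 keeps the divisor positive when c |h| = 0. *)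
    have K0 : 0 < c * nrm h + 1 by rewrite ltr_wpDl// mulr_ge0// nrm_ge0.
    have [|a b d|m Mm ym] :=
      orthogonal_trivial_dense _ _ Mtriv y (divr_gt0 e0 K0).
    - exact: psi0.
    - by rewrite /M /= psiL => -> ->; rewrite mulr0 add0r.
    have <- : rinner (T (y - m)) h = rinner (T y) h.
      by rewrite /rinner -!/(psi _) addrC -scaleN1r psiL Mm mulr0 add0r.
    apply: (@le_trans _ _ (nrm (T (y - m)) * nrm h)); first exact: rinner_le.
    apply: (@le_trans _ _ (c * nrm h * nrm (y - m))).
      by rewrite mulrAC ler_wpM2r ?nrm_ge0.
    rewrite -[leRHS](divfK (lt0r_neq0 K0)) [leRHS]mulrC.
    by apply: ler_pM; rewrite ?mulr_ge0 ?nrm_ge0 ?ler_wpDr// ltW.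
  have := re0 ('i%C *: x); have := re0 x; rewrite /rinner -!/(psi _) psiZ.
  case: (psi x) => a b /= ->; rewrite mul0r mul1r add0r => /eqP.
  by rewrite oppr_eq0 => /eqP ->.
have zz0 : inner z z != 0 by rewrite inner_normE sqrf_eq0 normr_eq0.
have pz0 : psi z != 0 by apply: contra zz0 => /eqP pz; rewrite zM.
(* The scalar is forced by <w, z> = conj (psi z); the kernel vector x - (psi x / psi z) z is
   orthogonal to [z], which settles every other [x]. *)
exists ((psi z)^* / inner z z *: z) => x; rewrite innerZl.
have : inner z ((- (psi x / psi z)) *: z + x) = 0.
  by apply: zM; rewrite /M /= psiL mulNr divfK// addNr.
rewrite innerDr innerZr => /eqP; rewrite addrC addr_eq0 => /eqP ->.
rewrite rmorphN mulNr opprK mulrCA divfK// rmorphM fmorphV/=.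
by rewrite divfK// conjC_eq0.
Qed.

End Riesz.

(** * Orthonormal vectors and Bessel's inequality *)

Section Orthonormal.
Context {R : realType} {V : hilbertType R}.

(** Unfolds to the summand of [sqr_sum]. *)
Definition sqmod (c : R[i]) : R := complex.Re `|c| ^+ 2.

Lemma sqmodE (c : R[i]) : (sqmod c)%:C%C = c * c^*.
Proof. by rewrite /sqmod rmorphXn -normCK. Qed.

Lemma sqmodM (a b : R[i]) : sqmod (a * b) = sqmod a * sqmod b.
Proof.
apply: (@complexI R).
transitivity ((sqmod a)%:C%C * (sqmod b)%:C%C); last by rewrite -rmorphM.
by rewrite !sqmodE rmorphM mulrACA.
Qed.

Lemma sqmod_ge0 (c : R[i]) : 0 <= sqmod c.
Proof. exact: sqr_ge0. Qed.

(** Constraining only the first [K] terms of a sequence on [nat] lets a vector be appended without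
    changing the index type. *)
Definition orthonormal_upto (K : nat) (e : nat -> V) :=
  forall i j, (i < K)%N -> (j < K)%N -> inner (e i) (e j) = (i == j)%:R.

Lemma inner_orthonormal K e (c : nat -> R[i]) j : orthonormal_upto K e ->
  (j < K)%N -> inner (\sum_(i < K) c i *: e i) (e j) = c j.
Proof.
move=> eK jK; rewrite (inner_suml _ (fun i => c i *: e i)).
rewrite (bigD1 (Ordinal jK))//= innerZl eK// eqxx mulr1 big1 ?addr0// => i ij.
rewrite innerZl eK// (_ : (i == j :> nat) = false) ?mulr0//.
by apply: contraNF ij => /eqP ij; apply/eqP/val_inj.
Qed.

Lemma bessel K e (x : V) : orthonormal_upto K e ->
  \sum_(k < K) sqmod (inner x (e k)) <= nrm x ^+ 2.
Proof.
move=> eK; set S := \sum_(k < K) _.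
pose s := \sum_(k < K) inner x (e k) *: e k.
(* Used for both x and s: <x, s> and |s|^2 have real part [S], so |x - s|^2 = |x|^2 - S. *)
have inners y : (forall k, (k < K)%N -> inner y (e k) = inner x (e k)) ->
    rinner y s = S.
  move=> yx; rewrite /rinner /s.
  rewrite (inner_sumr _ _ (fun k => inner x (e k) *: e k)).
  suff -> : \sum_(k < K) inner y (inner x (e k) *: e k) = S%:C%C by [].
  rewrite rmorph_sum; apply: eq_bigr => k _ /=.
  by rewrite sqmodE innerZr yx// mulrC.
have := sqr_ge0 (nrm (x - s)); rewrite nrm_sqrB (nrm_sqr s).
rewrite !inners//; last first.
  by move=> k kK; rewrite (inner_orthonormal (fun k => inner x (e k)) eK).
by lra.
Qed.

End Orthonormal.

(** * Bilinearity and induction for algebraic tensors *)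

Section AlgebraicTensor.
Context {R : realType} {U V : lmodType R[i]}.

Lemma pure_tensorDl (u u' : U) (v : V) : (u + u') ⊗ v = u ⊗ v + u' ⊗ v.
Proof.
rewrite /pure_tensor -pi_tensorD; apply/pi_tensorE; rewrite opprD addrA.
exact: BilinDl.
Qed.

Lemma pure_tensorDr (u : U) (v v' : V) : u ⊗ (v + v') = u ⊗ v + u ⊗ v'.
Proof.
rewrite /pure_tensor -pi_tensorD; apply/pi_tensorE; rewrite opprD addrA.
exact: BilinDr.
Qed.

Lemma pure_tensorZl (a : R[i]) (u : U) (v : V) : (a *: u) ⊗ v = a *: (u ⊗ v).
Proof.
by rewrite [RHS]scale_tensorE; apply/pi_tensorE; exact: BilinZl.
Qed.

Lemma pure_tensorZr (a : R[i]) (u : U) (v : V) : u ⊗ (a *: v) = a *: (u ⊗ v).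
Proof.
by rewrite [RHS]scale_tensorE; apply/pi_tensorE; exact: BilinZr.
Qed.

Lemma pure_tensor0l (v : V) : (0 : U) ⊗ v = 0.
Proof. by rewrite -[X in X ⊗ v](scale0r 0) pure_tensorZl scale0r. Qed.

Lemma pure_tensor_suml n (F : nat -> U) (v : V) :
  (\sum_(i < n) F i) ⊗ v = \sum_(i < n) F i ⊗ v.
Proof.
elim: n => [|n IHn]; first by rewrite !big_ord0 pure_tensor0l.
by rewrite !big_ord_recr /= pure_tensorDl IHn.
Qed.

(** Every class has a representative that is a finite combination of pairs, and each coefficient is
    absorbed into the left factor. *)
Lemma alg_tensor_ind (P : alg_tensor U V -> Prop) :
  P 0 -> (forall t u v, P t -> P (t + u ⊗ v)) -> forall t, P t.
Proof.
move=> P0 PD t; have [x ->] := pi_tensor_surj t.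
rewrite [x]monalgE; elim: (finmap.enum_fset _) => [|[u v] s IHs].
  by rewrite big_nil; rewrite /pi_tensor raddf0.
rewrite big_cons pi_tensorD addrC.
suff -> : pi_tensor << x@_(u, v) *g (u, v) >> = (x@_(u, v) *: u) ⊗ v.
  exact: PD.
rewrite pure_tensorZl [RHS]scale_tensorE; congr pi_tensor.
apply/malgP => k; rewrite mcoeffZ !mcoeffU.
by case: eqP => _; rewrite ?mulr1 ?mulr0.
Qed.

End AlgebraicTensor.

(** * Tensors with orthonormal left factors *)

Section GramSchmidt.
Context {R : realType} {H1 : hilbertType R} {H2 : lmodType R[i]}.

(** Adding [u ⊗ v] runs one Gram-Schmidt step on [u]: its coefficients along the [e k] move into the
    right factors, and a nonzero remainder [r] is normalized and appended. *)
Lemma alg_tensor_orthonormal (t : alg_tensor H1 H2) :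
  exists K e (y : nat -> H2),
    @orthonormal_upto R H1 K e /\ t = \sum_(k < K) e k ⊗ y k.
Proof.
move: t; apply: (@alg_tensor_ind R H1 H2) => [|t u v [K [e [y [eK ->]]]]].
  by exists 0%N, (fun=> 0), (fun=> 0); split=> //; rewrite big_ord0.
pose c k := inner u (e k); pose r := u - \sum_(k < K) c k *: e k.
have re j : (j < K)%N -> inner r (e j) = 0.
  by move=> jK; rewrite innerDl innerNl (inner_orthonormal _ eK)// subrr.
have uE : u = \sum_(k < K) c k *: e k + r by rewrite addrC subrK.
have uvE : u ⊗ v = \sum_(k < K) e k ⊗ (c k *: v) + r ⊗ v.
  rewrite {1}uE pure_tensorDl (pure_tensor_suml _ (fun k => c k *: e k)).
  by congr (_ + _); apply: eq_bigr => k _; rewrite pure_tensorZl pure_tensorZr.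
have [r0|r0] := eqVneq r 0.
  exists K, e, (fun k => y k + c k *: v); split=> //.
  rewrite uvE r0 pure_tensor0l addr0 -big_split.
  by apply: eq_bigr => k _; rewrite pure_tensorDr.
have nr0 : `|r| != 0 by rewrite normr_eq0.
(* The norm of [r] moves to the right factor: (|r|^-1 r) ⊗ (|r| v) = r ⊗ v. *)
exists K.+1, (fun k => if (k < K)%N then e k else `|r|^-1 *: r),
  (fun k => if (k < K)%N then y k + c k *: v else `|r| *: v); split.
  move=> i j; rewrite !ltnS => iK jK; case: ltnP => iK'; case: ltnP => jK'.
  - exact: eK.
  - rewrite innerZr innerC re// conjC0 mulr0 (_ : (i == j) = false)//.
    by apply/ltn_eqF/(leq_trans iK').
  - rewrite innerZl re// mulr0 (_ : (i == j) = false)//.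
    by apply/gtn_eqF/(leq_trans jK').
  - rewrite (_ : (i == j)) ?eqn_leq ?(leq_trans iK)// ?(leq_trans jK)//.
    rewrite innerZl innerZr inner_normE conj_Creal ?rpredV ?normr_real//.
    by rewrite expr2 mulKf// mulVf.
rewrite big_ord_recr /= ltnn uvE addrA -big_split/=; congr (_ + _).
  by apply: eq_bigr => k _; rewrite ltn_ord pure_tensorDr.
by rewrite pure_tensorZl pure_tensorZr scalerA mulVf// scale1r.
Qed.

End GramSchmidt.


(** * Double sums of squares *)

Section SumsOfSquares.
Context {R : realType}.

Lemma esumZl (a : nat -> \bar R) (c : R) : 0 <= c -> (forall n, 0 <= a n)%E ->
  (\esum_(n in [set: nat]) (c%:E * a n) =
   c%:E * \esum_(n in [set: nat]) a n)%E.
Proof.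
move=> c0 a0; rewrite -!nneseries_esumT ?nneseriesZl// => n.
by rewrite mule_ge0// lee_fin.
Qed.

Lemma esum_pair (a : nat -> nat -> \bar R) : (forall n m, 0 <= a n m)%E ->
  (\esum_(k in [set: nat * nat]) a k.1 k.2 =
   \esum_(n in [set: nat]) \esum_(m in [set: nat]) a n m)%E.
Proof.
move=> a0; rewrite esum_esum//; congr esum.
by apply/seteqP; split.
Qed.

Lemma esum_exchange (a : nat -> nat -> \bar R) : (forall n m, 0 <= a n m)%E ->
  (\esum_(n in [set: nat]) \esum_(m in [set: nat]) a n m =
   \esum_(m in [set: nat]) \esum_(n in [set: nat]) a n m)%E.
Proof.
move=> a0; rewrite -!nneseries_esumT; last 2 first.
- by move=> n; apply: esum_ge0.
- by move=> n; apply: esum_ge0.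
under eq_eseriesr do rewrite -nneseries_esumT//.
rewrite nneseries_interchange//.
by under eq_eseriesr do rewrite nneseries_esumT//.
Qed.

Lemma sqr_sum_ge0 (I : choiceType) (c : I -> R[i]) : (0 <= sqr_sum c)%E.
Proof. by apply: esum_ge0 => i _; rewrite lee_fin sqr_ge0. Qed.

Lemma sqr_sum_mul (a b : nat -> R[i]) (s : R) : sqr_sum b = s%:E ->
  sqr_sum (fun nm : nat * nat => a nm.1 * b nm.2) = (s%:E * sqr_sum a)%E.
Proof.
move=> bs; have s0 : 0 <= s by rewrite -lee_fin -bs sqr_sum_ge0.
have sq0 (c : R[i]) : (0 <= (sqmod c)%:E)%E by rewrite lee_fin sqmod_ge0.
rewrite /sqr_sum.
rewrite (esum_pair (a := fun n m => (sqmod (a n * b m))%:E))//.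
rewrite -esumZl// ; last by move=> n; exact: sq0.
apply: eq_esum => n _; rewrite muleC -bs -esumZl ?sqmod_ge0//; last first.
  by move=> m; exact: sq0.
by apply: eq_esum => m _; rewrite sqmodM EFinM.
Qed.

(** Lets the factorization be used when it is the first factor whose sum is known to be finite. *)
Lemma sqr_sum_mulC (a b : nat -> R[i]) :
  sqr_sum (fun nm : nat * nat => a nm.1 * b nm.2) =
  sqr_sum (fun nm : nat * nat => b nm.1 * a nm.2).
Proof.
have sq0 (c : R[i]) : (0 <= (sqmod c)%:E)%E by rewrite lee_fin sqmod_ge0.
rewrite /sqr_sum.
rewrite (esum_pair (a := fun n m => (sqmod (a n * b m))%:E))//.
rewrite (esum_pair (a := fun n m => (sqmod (b n * a m))%:E))//.
rewrite esum_exchange//; apply: eq_esum => m _; apply: eq_esum => n _.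
by rewrite mulrC.
Qed.

End SumsOfSquares.

(** * Linear spans, completeness and lower bounds *)

Section LowerBounds.
Context {R : realType} {V : hilbertType R}.

Lemma lin_span_linear (A : set V) (a : R[i]) (x y : V) :
  lin_span A x -> lin_span A y -> lin_span A (a *: x + y).
Proof.
move=> [m [c [v [Av ->]]]] [n [d [w [Aw ->]]]].
exists (m + n)%N,
  (fun i => match fintype.split i with inl j => a * c j | inr j => d j end),
  (fun i => match fintype.split i with inl j => v j | inr j => w j end); split.
  by move=> i; case: (fintype.split i).
rewrite big_split_ord scaler_sumr; congr (_ + _); apply: eq_bigr => i _.
  by rewrite scalerA (unsplitK (inl i)).
by rewrite (unsplitK (inr i)).
Qed.

Lemma lin_span0 (A : set V) : lin_span A 0.
Proof.
exists 0%N, (fun=> 0), (fun=> 0); split; first by case.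
by rewrite big_ord0.
Qed.

Lemma lin_span_sub (A : set V) : A `<=` lin_span A.
Proof.
move=> x Ax; exists 1%N, (fun=> 1), (fun=> x); split=> //.
by rewrite big_ord1 scale1r.
Qed.

Lemma lower_bound_complete (I : countType) (f : I -> V) (A : R) : 0 < A ->
  (forall x, ((A * nrm x ^+ 2)%:E <= sqr_sum (analysis f x))%E) ->
  complete_family f.
Proof.
move=> A0 fA; apply/seteqP; split=> // x _; apply/closure_nrm.
apply: orthogonal_trivial_dense; [exact: lin_span0 | exact: lin_span_linear |].
move=> z zf; have := fA z; rewrite [sqr_sum _]esum1; last first.
  move=> i _; rewrite /analysis zf ?normr0 ?expr0n//.
  by apply: lin_span_sub; exists i.
rewrite lee_fin pmulr_rle0// => z0; apply/eqP; rewrite -nrm_eq0.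
by rewrite -(@sqrf_eq0 R); apply/eqP/le_anti; rewrite z0 sqr_ge0.
Qed.

(** Here [s] stands for the finite sum of squares of one family at a fixed vector, and [S] for the
    possibly infinite sum of the other family. *)
Lemma lower_bound_divide (S : V -> \bar R) (k s : R) : 0 < k -> 0 <= s ->
  (exists x : V, x != 0) ->
  (forall x, ((k * nrm x ^+ 2)%:E <= s%:E * S x)%E) ->
  exists2 A : R, 0 < A & forall x, ((A * nrm x ^+ 2)%:E <= S x)%E.
Proof.
(* If [s = 0], then [s%:E * S x] is 0 even for infinite [S x], against the positive left side at a
   nonzero [x]. *)
move=> k0; rewrite le_eqVlt => /predU1P[<- [x x0] /(_ x)|s0 _ kS].
  rewrite mul0e lee_fin pmulr_rle0// leNgt exprn_gt0//.
  by rewrite lt0r nrm_eq0 x0 nrm_ge0.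
exists (k / s); first exact: divr_gt0.
by move=> x; rewrite mulrAC mulrC EFinM lee_pdivrMl.
Qed.

Lemma dense_neq0 (S : set V) : dense S -> (exists x : V, x != 0) ->
  exists2 y, S y & y != 0.
Proof.
move=> dS [x x0]; have nx : 0 < nrm x by rewrite lt0r nrm_eq0 x0 nrm_ge0.
have [y Sy xy] := dense_nrm dS x nx; exists y => //.
by apply: contraTneq xy => ->; rewrite subr0 ltxx.
Qed.

End LowerBounds.

(** * Frame bounds in the Hilbert tensor product *)

Section TensorFrames.
Context {R : realType} {H1 H2 H : hilbertType R}.
Variable iota : {linear alg_tensor H1 H2 -> H}.
Hypothesis iotaP : is_hilbert_tensor iota.

Let iota_inner (f1 f2 : H1) (g1 g2 : H2) :
  inner (iota (f1 ⊗ g1)) (iota (f2 ⊗ g2)) = inner f1 f2 * inner g1 g2.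
Proof. exact: iotaP.1. Qed.

Lemma nrm_pure_tensor u v : nrm (iota (u ⊗ v)) = nrm u * nrm v.
Proof.
apply: (@complexI R).
transitivity ((nrm u)%:C%C * (nrm v)%:C%C); last by rewrite -rmorphM.
rewrite !nrmE; apply/eqP; rewrite -(@eqrXn2 _ 2)// ?mulr_ge0//.
by rewrite exprMn -!inner_normE iota_inner.
Qed.

Lemma nrm_sqr_orthonormal_tensor K (e : nat -> H1) (y : nat -> H2) :
  orthonormal_upto K e ->
  nrm (\sum_(k < K) iota (e k ⊗ y k)) ^+ 2 = \sum_(k < K) nrm (y k) ^+ 2.
Proof.
move=> eK; rewrite nrm_sqr /rinner (inner_suml _ (fun k => iota (e k ⊗ y k))).
suff -> : \sum_(k < K)
    inner (iota (e k ⊗ y k)) (\sum_(j < K) iota (e j ⊗ y j)) =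
    (\sum_(k < K) nrm (y k) ^+ 2)%:C%C by [].
rewrite rmorph_sum; apply: eq_bigr => k _.
rewrite (inner_sumr _ _ (fun k => iota (e k ⊗ y k))).
rewrite (bigD1 k)//= iota_inner eK// eqxx mul1r big1 ?addr0 => [|j jk].
  by rewrite inner_normE -nrmE -rmorphXn.
rewrite iota_inner eK// (_ : (k == j :> nat) = false) ?mul0r//.
by apply: contraNF jk => /eqP kj; apply/eqP/val_inj.
Qed.

(** The vector [w] is the contraction of [h] against [v]; it exists because x -> iota (x ⊗ v) is
    bounded with constant |v|. *)
Lemma riesz_left (h : H) (v : H2) :
  exists w, forall x : H1, inner w x = inner h (iota (x ⊗ v)).
Proof.
apply: (@riesz_adjoint _ _ _ (fun x => iota (x ⊗ v)) h (nrm v)).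
- exact: nrm_ge0.
- by move=> a x y; rewrite pure_tensorDl pure_tensorZl linearP.
- by move=> x; rewrite nrm_pure_tensor mulrC.
Qed.

Lemma riesz_right (h : H) (u : H1) :
  exists w, forall y : H2, inner w y = inner h (iota (u ⊗ y)).
Proof.
apply: (@riesz_adjoint _ _ _ (fun y => iota (u ⊗ y)) h (nrm u)).
- exact: nrm_ge0.
- by move=> a x y; rewrite pure_tensorDr pure_tensorZr linearP.
- by move=> x; rewrite nrm_pure_tensor.
Qed.

Variables (f : nat -> H1) (g : nat -> H2).
Local Notation fg := (fun nm : nat * nat => iota (f nm.1 ⊗ g nm.2)).

Lemma slices_le_sqr_sum (A B : R) (h : H) (K : nat) (e : nat -> H1)
    (w : nat -> H2) : 0 < A -> 0 < B ->
  (forall x, ((A * nrm x ^+ 2)%:E <= sqr_sum (analysis f x))%E) ->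
  (forall y, ((B * nrm y ^+ 2)%:E <= sqr_sum (analysis g y))%E) ->
  orthonormal_upto K e ->
  (forall k y, inner (w k) y = inner h (iota (e k ⊗ y))) ->
  ((A * (B * \sum_(k < K) nrm (w k) ^+ 2))%:E <= sqr_sum (analysis fg h))%E.
Proof.
move=> A0 B0 fA gB eK wP.
have sq0 (c : R[i]) : (0 <= (sqmod c)%:E)%E by rewrite lee_fin sqmod_ge0.
have /choice[v vP] := fun m => riesz_left h (g m).
(* The bound for [g] applies to each [w k]; since <w k, g m> = <v m, e k>, Bessel's inequality for
   [v m] controls the sum over k. *)
have wv : ((B * \sum_(k < K) nrm (w k) ^+ 2)%:E <=
    \esum_(m in [set: nat]) (nrm (v m) ^+ 2)%:E)%E.
  rewrite mulr_sumr -sumEFin.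
  apply: (@le_trans _ _ (\sum_(k < K) sqr_sum (analysis g (w k)))%E).
    by apply: lee_sum => k _; exact: gB.
  rewrite -esum_sum// => [|m k _ _]; last exact: sq0.
  apply: le_esum => m _; rewrite sumEFin lee_fin.
  apply: le_trans (bessel (v m) eK); apply: ler_sum => k _.
  by rewrite /analysis wP vP.
rewrite EFinM.
apply: (@le_trans _ _ (A%:E * \esum_(m in [set: nat]) (nrm (v m) ^+ 2)%:E)%E).
  by apply: lee_wpmul2l wv; rewrite lee_fin ltW.
rewrite -esumZl ?(ltW A0)//; last by move=> m; rewrite lee_fin sqr_ge0.
(* The sum over m is moved outside so that the inner sum over n is the one bounded below by [fA] at
   [v m]. *)
rewrite [leRHS](esum_pair
  (a := fun n m => (sqmod (inner h (iota (f n ⊗ g m))))%:E))//.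
rewrite esum_exchange//; apply: le_esum => m _.
apply: le_trans (fA (v m)) _; apply: le_esum => n _.
by rewrite /analysis vP.
Qed.

Lemma tensor_lower_bound (A B : R) : 0 < A -> 0 < B ->
  (forall x, ((A * nrm x ^+ 2)%:E <= sqr_sum (analysis f x))%E) ->
  (forall y, ((B * nrm y ^+ 2)%:E <= sqr_sum (analysis g y))%E) ->
  forall h, ((A * B * nrm h ^+ 2)%:E <= sqr_sum (analysis fg h))%E.
Proof.
move=> A0 B0 fA gB h; apply/lee_addgt0Pr => eps eps0.
have AB0 : 0 < A * B by apply: mulr_gt0.
have d0 : 0 < eps / (A * B) by apply: divr_gt0.
(* The radius makes A B |h - iota t|^2 at most [eps]. *)
have [_ [t _ <-] ht] : exists2 x, range iota x &
    nrm (h - x) < Num.sqrt (eps / (A * B)).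
  by apply: dense_nrm iotaP.2 _ _ _; rewrite sqrtr_gt0.
have [K [e [y [eK tE]]]] := alg_tensor_orthonormal t.
have /choice[w wP] := fun k => riesz_right h (e k).
pose W := \sum_(k < K) nrm (w k) ^+ 2.
have tS : iota t = \sum_(k < K) iota (e k ⊗ y k) by rewrite tE linear_sum.
(* The left side is 2 Re<h, iota t> - |iota t|^2, which splits into the terms 2 Re<w k, y k> - |y
   k|^2 <= |w k|^2. *)
have WP : nrm h ^+ 2 - nrm (h - iota t) ^+ 2 <= W.
  rewrite nrm_sqrB {1}tS nrm_sqr_orthonormal_tensor//.
  have -> : rinner h (iota t) = \sum_(k < K) rinner (w k) (y k).
    rewrite /rinner tS (inner_sumr _ _ (fun k => iota (e k ⊗ y k))).
    elim/big_rec2: _ => [|k a b _ <-] //; rewrite wP.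
    by case: b => ? ?; case: (inner _ _).
  rewrite opprD opprD !opprK addrA addrA subrr add0r addrC mulr_sumr.
  rewrite -sumrB; apply: ler_sum => k _.
  by have := sqr_ge0 (nrm (w k - y k)); rewrite nrm_sqrB; lra.
have dP : nrm (h - iota t) ^+ 2 <= eps / (A * B).
  rewrite -[leRHS]sqr_sqrtr ?(ltW d0)//.
  by rewrite ler_pXn2r ?nnegrE ?nrm_ge0 ?sqrtr_ge0// ltW.
apply: (@le_trans _ _ ((A * (B * W))%:E + eps%:E)%E); last first.
  by rewrite leeD2r//; exact: slices_le_sqr_sum wP.
rewrite -EFinD lee_fin mulrA -[in leRHS](divfK (lt0r_neq0 AB0) eps).
by rewrite [_ / _ * _]mulrC -mulrDr ler_pM2l//; lra.
Qed.

Lemma sqr_sum_pure_tensor (x : H1) (y : H2) (s : R) :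
  sqr_sum (analysis g y) = s%:E ->
  sqr_sum (analysis fg (iota (x ⊗ y))) = (s%:E * sqr_sum (analysis f x))%E.
Proof.
move=> ys; rewrite -(sqr_sum_mul _ ys).
by congr sqr_sum; apply/funext => nm; rewrite /analysis iota_inner.
Qed.

Lemma sqr_sum_pure_tensorC (x : H1) (y : H2) (s : R) :
  sqr_sum (analysis f x) = s%:E ->
  sqr_sum (analysis fg (iota (x ⊗ y))) = (s%:E * sqr_sum (analysis g y))%E.
Proof.
move=> xs; rewrite -(sqr_sum_mul _ xs) sqr_sum_mulC.
by congr sqr_sum; apply/funext => nm; rewrite /analysis iota_inner.
Qed.

End TensorFrames.

Lemma sqr_sum_fin (R : realType) (V : hilbertType R) (f : nat -> V) (x : V) :
  analysis_dom f x -> exists2 s : R, 0 <= s & sqr_sum (analysis f x) = s%:E.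
Proof.
move=> fx; have s0 := sqr_sum_ge0 (analysis f x).
exists (fine (sqr_sum (analysis f x))); first exact: fine_ge0.
by rewrite fineK// ge0_fin_numE.
Qed.

(** If one factor were zero, so would be the tensor product, where every family is a lower
    semi-frame whatever the other factor's family is; hence the nonzero hypotheses. *)
Theorem theorem3p2 (R : realType) (H1 H2 H : hilbertType R)
  (iota : {linear alg_tensor H1 H2 -> H})
  (H_tensor : is_hilbert_tensor iota)
  (H1_separable : separable H1) (H2_separable : separable H2)
  (H1_neq0 : exists x : H1, x != 0) (H2_neq0 : exists y : H2, y != 0)
  (f : nat -> H1) (g : nat -> H2)
  (f_dense : analysis_densely_defined f)
  (g_dense : analysis_densely_defined g) :
  lower_semi_frame f /\ lower_semi_frame g <->
  lower_semi_frame (fun nm : nat * nat => iota (f nm.1 ⊗ g nm.2)).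
Proof.
split=> [[[_ [A A0 fA]] [_ [B B0 gB]]]|[_ [A A0 fgA]]].
  have AB0 : 0 < A * B by apply: mulr_gt0.
  have fgAB := tensor_lower_bound H_tensor A0 B0 fA gB.
  by split; [exact: lower_bound_complete AB0 fgAB | exists (A * B)].
split.
  have [y /sqr_sum_fin[s s0 ys] y0] := dense_neq0 g_dense H2_neq0.
  (* At x ⊗ y the tensor bound reads (A |y|^2) |x|^2 <= s S(x), with S(x) the sum of squares of [f]
     at x; dividing by [s] bounds [f]. *)
  have k0 : 0 < A * nrm y ^+ 2.
    by rewrite mulr_gt0// exprn_gt0// lt0r nrm_eq0 y0 nrm_ge0.
  have [B B0 fB] : exists2 B : R, 0 < B &
      forall x, ((B * nrm x ^+ 2)%:E <= sqr_sum (analysis f x))%E.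
    apply: (lower_bound_divide k0 s0 H1_neq0) => x.
    rewrite -(sqr_sum_pure_tensor H_tensor f x ys); apply: le_trans (fgA _).
    rewrite -/(nrm _) (nrm_pure_tensor H_tensor) exprMn -mulrA.
    by rewrite [_ ^+ 2 * _]mulrC.
  by split; [exact: lower_bound_complete B0 fB | exists B].
have [x /sqr_sum_fin[s s0 xs] x0] := dense_neq0 f_dense H1_neq0.
have k0 : 0 < A * nrm x ^+ 2.
  by rewrite mulr_gt0// exprn_gt0// lt0r nrm_eq0 x0 nrm_ge0.
have [B B0 gB] : exists2 B : R, 0 < B &
    forall y, ((B * nrm y ^+ 2)%:E <= sqr_sum (analysis g y))%E.
  apply: (lower_bound_divide k0 s0 H2_neq0) => y.
  rewrite -(sqr_sum_pure_tensorC H_tensor g y xs); apply: le_trans (fgA _).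
  by rewrite -/(nrm _) (nrm_pure_tensor H_tensor) exprMn -mulrA.
by split; [exact: lower_bound_complete B0 gB | exists B].
Qed.
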